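(* Let $n\geqslant 1$ and let $\mathrm{h}_n$ be the Heisenberg algebra of dimension $2n+1$ over a field of characteristic $0$, with canonical basis $\{e,p_1,\dots,p_n,q_1,\dots,q_n\}$. A linear operator on $\mathrm{h}_n$ is Lie-orthogonal if and only if its matrix in the canonical basis has the form \[ \left(\begin{array}{cc} r & R\\ 0 & \hat J\end{array}\right), \] where $r$ is an arbitrary scalar, $R$ is an arbitrary $1\times 2n$ matrix, $0$ denotes the zero $2n\times 1$ matrix, and $\hat J$ is an arbitrary matrix from $\mathrm{Sp}_{2n}$.
   Context: A linear operator $J$ on a Lie algebra $L$ is called Lie-orthogonal if $[Jx,Jy]=[x,y]$ for all $x,y\in L$. The Heisenberg algebra $\mathrm{h}_n$ is the $(2n+1)$-dimensional Lie algebra with basis $\{e,p_1,\dots,p_n,q_1,\dots,q_n\}$ (the canonical basis) whose nonzero commutation relations are exhausted by $[p_j,q_j]=e$, $j=1,\dots,n$ (up to skew-symmetry). The columns of the matrix of an operator are the coordinates of the images of the basis elements. $\mathrm{Sp}_{2n}$ is the group of $2n\times 2n$ matrices $M$ over the ground field with $M^{\mathrm T}SM=S$, where $S=\begin{pmatrix} 0 & -E \\ E & 0 \end{pmatrix}$ and $E$ is the $n\times n$ unit matrix. *)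

(* Defs.v *)
From HB Require Import structures.
From mathcomp Require Import all_boot all_order all_algebra.

Set Implicit Arguments.
Unset Strict Implicit.
Unset Printing Implicit Defensive.

Import GRing.Theory.
Local Open Scope ring_scope.

HB.mixin Record isLieAlgebra (F : fieldType) L of Vector F L := {
  lie : L -> L -> L;
  lie_linearl : forall y : L, linear (lie^~ y);
  lie_linearr : forall x : L, linear (lie x);
  lie_alt : forall x : L, lie x x = 0;
  lie_jacobi : forall x y z : L,
    lie x (lie y z) + lie y (lie z x) + lie z (lie x y) = 0
}.

#[short(type="lieAlgType")]
HB.structure Definition LieAlgebra (F : fieldType) :=
  { L of Vector F L & isLieAlgebra F L }.

Definition lie_orthogonal (F : fieldType) (L : lieAlgType F) (J : 'End(L)) : Prop :=
  forall x y : L, lie (J x) (J y) = lie x y.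

(* The relations not listed follow by skew-symmetry. *)
Record heisenberg_basis (F : fieldType) (L : lieAlgType F) (n : nat)
    (e : L) (p q : n.-tuple L) : Prop := HeisenbergBasis {
  heis_basis : basis_of fullv (e :: p ++ q);
  heis_ep : forall i : 'I_n, lie e (tnth p i) = 0;
  heis_eq : forall i : 'I_n, lie e (tnth q i) = 0;
  heis_pp : forall i j : 'I_n, lie (tnth p i) (tnth p j) = 0;
  heis_qq : forall i j : 'I_n, lie (tnth q i) (tnth q j) = 0;
  heis_pq : forall i j : 'I_n,
    lie (tnth p i) (tnth q j) = if i == j then e else 0
}.

(* Column convention: column j holds the coordinates of J X_j, so this is the
   transpose of [mxof X X J], which acts on row vectors. *)
Definition op_mx (F : fieldType) (V : vectType F) (m : nat) (X : m.-tuple V)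
    (J : 'End(V)) : 'M[F]_m :=
  \matrix_(i, j) coord X i (J (tnth X j)).

Definition symp_form (F : fieldType) (n : nat) : 'M[F]_(n + n) :=
  block_mx 0 (- 1%:M) 1%:M 0.

Definition Sp (F : fieldType) (n : nat) : {pred 'M[F]_(n + n)} :=
  [pred M | M^T *m symp_form F n *m M == symp_form F n].
Arguments Sp : clear implicits.

(* The coordinate model shows that Heisenberg algebras exist for every n. *)

Definition heis (F : fieldType) (n : nat) : Type := 'rV[F]_(1 + (n + n)).

Section HeisenbergModel.
Variables (F : fieldType) (n : nat).

HB.instance Definition _ := Vector.copy (heis F n) 'rV[F]_(1 + (n + n)).

Let ie : 'I_(1 + (n + n)) := lshift (n + n) ord0.
Let ip (i : 'I_n) : 'I_(1 + (n + n)) := rshift 1 (lshift n i).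
Let iq (i : 'I_n) : 'I_(1 + (n + n)) := rshift 1 (rshift n i).

Definition heis_e : heis F n := delta_mx 0 ie : 'rV_(1 + (n + n)).
Definition heis_p : n.-tuple (heis F n) :=
  [tuple (delta_mx 0 (ip i) : 'rV_(1 + (n + n))) | i < n].
Definition heis_q : n.-tuple (heis F n) :=
  [tuple (delta_mx 0 (iq i) : 'rV_(1 + (n + n))) | i < n].

Definition heis_form (u v : 'rV[F]_(1 + (n + n))) : F :=
  \sum_i (u 0 (ip i) * v 0 (iq i) - u 0 (iq i) * v 0 (ip i)).

Definition heis_lie (u v : heis F n) : heis F n := heis_form u v *: heis_e.

Let form_linl (v : 'rV[F]_(1 + (n + n))) a u w :
  heis_form (a *: u + w) v = a * heis_form u v + heis_form w v.
Proof.
rewrite /heis_form mulr_sumr -big_split; apply: eq_bigr => i _ /=.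
rewrite !mxE !mulrDl mulrBr !mulrA opprD.
by rewrite addrACA.
Qed.

Let form_anti (u v : 'rV[F]_(1 + (n + n))) : heis_form u v = - heis_form v u.
Proof.
rewrite /heis_form -sumrN; apply: eq_bigr => i _.
by rewrite opprB mulrC [X in _ - X]mulrC.
Qed.

Let form_e (u : 'rV[F]_(1 + (n + n))) : heis_form u heis_e = 0.
Proof.
rewrite /heis_form big1 // => i _.
by rewrite !mxE !eq_rlshift !andbF !mulr0 subrr.
Qed.

Let form_linr (u : 'rV[F]_(1 + (n + n))) a v w :
  heis_form u (a *: v + w) = a * heis_form u v + heis_form u w.
Proof.
by rewrite form_anti form_linl opprD -mulrN -!form_anti.
Qed.

Fact heis_lie_linearl (v : heis F n) : linear (heis_lie^~ v).
Proof. by move=> a u w; rewrite /heis_lie form_linl scalerDl scalerA. Qed.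

Fact heis_lie_linearr (u : heis F n) : linear (heis_lie u).
Proof. by move=> a v w; rewrite /heis_lie form_linr scalerDl scalerA. Qed.

Fact heis_lie_alt (u : heis F n) : heis_lie u u = 0.
Proof.
rewrite /heis_lie /heis_form big1 ?scale0r // => i _.
by rewrite mulrC subrr.
Qed.

Let heis_lie2 (u v w : heis F n) : heis_lie u (heis_lie v w) = 0.
Proof.
rewrite /heis_lie -[X in heis_form u X]addr0 form_linr form_e mulr0 add0r.
rewrite /heis_form big1 ?scale0r // => i _.
by rewrite !mxE !mulr0 subrr.
Qed.

Fact heis_lie_jacobi (u v w : heis F n) :
  heis_lie u (heis_lie v w) + heis_lie v (heis_lie w u)
    + heis_lie w (heis_lie u v) = 0.
Proof. by rewrite !heis_lie2 !addr0. Qed.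

HB.instance Definition _ := isLieAlgebra.Build F (heis F n)
  heis_lie_linearl heis_lie_linearr heis_lie_alt heis_lie_jacobi.

Lemma heis_canonical_basis : heisenberg_basis heis_e heis_p heis_q.
Proof.
have form_d (j k : 'I_(1 + (n + n))) :
    heis_form (delta_mx 0 j) (delta_mx 0 k) =
    \sum_i ((ip i == j)%:R * (iq i == k)%:R - (iq i == j)%:R * (ip i == k)%:R).
  by apply: eq_bigr => i _; rewrite !mxE !eqxx.
have anti (u v : heis F n) : heis_form u v = 0 -> lie u v = 0.
  by move=> h; rewrite /lie /= /heis_lie h scale0r.
split.
- rewrite basisEdim dimvf.
  have -> : dim (heis F n) = (1 + (n + n))%N by rewrite -[RHS]mul1n.
  have -> : (size (heis_e :: heis_p ++ heis_q) <= 1 + (n + n))%N.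
    by rewrite /= size_cat !size_tuple !card_ord.
  rewrite andbT; apply/subvP => u _.
  have -> : u = \sum_j (u : 'rV_(1 + (n + n))) 0 j *:
                  (delta_mx 0 j : 'rV[F]_(1 + (n + n))).
    exact: row_sum_delta.
  apply: memv_suml => j _; apply/memvZ/memv_span.
  rewrite inE mem_cat; case: (split_ordP j) => [k ->|k ->].
    by rewrite ord1 eqxx.
  case: (split_ordP k) => i ->; apply/orP; right; apply/orP.
    by left; apply/mapP; exists i; rewrite ?mem_enum.
  by right; apply/mapP; exists i; rewrite ?mem_enum.
- by move=> i; apply: anti; rewrite form_anti form_e oppr0.
- by move=> i; apply: anti; rewrite form_anti form_e oppr0.
- move=> i j; apply: anti; rewrite !tnth_mktuple form_d big1 // => k _.
  by rewrite !eq_rshift !eq_rlshift mulr0 mul0r subrr.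
- move=> i j; apply: anti; rewrite !tnth_mktuple form_d big1 // => k _.
  by rewrite !eq_rshift !eq_lrshift mulr0 mul0r subrr.
- move=> i j; rewrite !tnth_mktuple {1}/lie /= /heis_lie form_d.
  rewrite (bigD1 i) //= big1 ?addr0 => [|k nki].
    rewrite !eqxx !eq_rshift !eq_rlshift mul0r subr0 mul1r.
    by case: ifP => _; rewrite ?scale1r ?scale0r.
  by rewrite !eq_rshift eq_lshift eq_rlshift (negPf nki) !mul0r subrr.
Qed.

End HeisenbergModel.

(* Main.v *)
(** With [T = block_mx 0 0 0 S], the bracket in the canonical basis [X] is
    [lie x y = - (x^T T y) e].  Hence an operator with matrix [A] is
    Lie-orthogonal iff [A^T T A = T].  If [c] is the lower left block of [A] and
    [M] its lower right block, this contains [M^T S M = S] and [c^T S M = 0]; the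
    former makes [S M] invertible, so the latter forces [c = 0]. *)

Require Import Defs.
From HB Require Import structures.
From mathcomp Require Import all_boot all_order all_algebra.

Set Implicit Arguments.
Unset Strict Implicit.
Unset Printing Implicit Defensive.

Import GRing.Theory.
Local Open Scope ring_scope.

Section LieBilinear.
Variables (F : fieldType) (L : lieAlgType F).
Implicit Types x y : L.

(** A named form of [lie^~ y], so that linearity in the left argument can also be declared as an
    instance. *)
Definition lier y x := lie x y.

HB.instance Definition _ x := GRing.isLinear.Build F L L _ (lie x) (lie_linearr x).
HB.instance Definition _ y := GRing.isLinear.Build F L L _ (lier y) (lie_linearl y).

Lemma lie_suml (I : finType) (a : I -> F) (u : I -> L) y :
  lie (\sum_i a i *: u i) y = \sum_i a i *: lie (u i) y.
Proof.
rewrite -[LHS]/(lier y _) linear_sum; apply: eq_bigr => i _.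
by rewrite linearZ.
Qed.

Lemma lie_sumr (I : finType) (a : I -> F) (u : I -> L) x :
  lie x (\sum_i a i *: u i) = \sum_i a i *: lie x (u i).
Proof. by rewrite linear_sum; apply: eq_bigr => i _; rewrite linearZ. Qed.

Lemma lie_anti x y : lie x y = - lie y x.
Proof.
apply/eqP; rewrite -addr_eq0; apply/eqP.
have lieDl u v z : lie (u + v) z = lie u z + lie v z := linearD (lier z) u v.
have := lie_alt (x + y); rewrite linearD /= !lieDl.
by rewrite !lie_alt add0r addr0 addrC.
Qed.

Lemma lie_orthogonal_basis m (X : m.-tuple L) (J : 'End(L)) :
  basis_of fullv X ->
  lie_orthogonal J <->
  forall i j, lie (J (tnth X i)) (J (tnth X j)) = lie (tnth X i) (tnth X j).
Proof.
move=> bX; split=> [oJ i j|oJ x y]; first exact: oJ.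
have expX u : u = \sum_i coord X i u *: tnth X i.
  rewrite {1}(coord_basis bX (memvf u)).
  by apply: eq_bigr => i _; rewrite -tnth_nth.
have expJ u : J u = \sum_i coord X i u *: J (tnth X i).
  by rewrite {1}(expX u) linear_sum; apply: eq_bigr => i _; rewrite linearZ.
rewrite [in RHS](expX x) [in RHS](expX y) (expJ x) (expJ y) !lie_sumr.
apply: eq_bigr => j _; congr (_ *: _); rewrite !lie_suml.
by apply: eq_bigr => i _; rewrite oJ.
Qed.

(** All brackets lie on the line through [e], so the bracket is a scalar bilinear form with Gram
    matrix [T]. The images of the basis vectors are the columns of [A], and their Gram matrix is
    [A^T *m T *m A]. *)
Lemma lie_orthogonal_mx m (X : m.-tuple L) (e : L) (T : 'M[F]_m) (J : 'End(L)) :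
    basis_of fullv X -> e != 0 ->
    (forall i j, lie (tnth X i) (tnth X j) = T i j *: e) ->
  lie_orthogonal J <-> (op_mx X J)^T *m T *m op_mx X J = T.
Proof.
move=> bX e0 lieX; set A := op_mx X J.
have JX i : J (tnth X i) = \sum_k A k i *: tnth X k.
  rewrite {1}(coord_basis bX (memvf (J (tnth X i)))).
  by apply: eq_bigr => k _; rewrite mxE -tnth_nth.
have lieJX i j : lie (J (tnth X i)) (J (tnth X j)) = (A^T *m T *m A) i j *: e.
  rewrite !JX lie_sumr mxE scaler_suml; apply: eq_bigr => l _.
  rewrite lie_suml [(_ *m T) i l]mxE mulr_suml scaler_suml scaler_sumr; apply: eq_bigr => k _.
  by rewrite lieX !scalerA [A^T i k]mxE [_ * A l j]mulrC mulrA.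
split=> [oJ|eqT]; last first.
  by apply/(lie_orthogonal_basis _ bX) => i j; rewrite lieJX eqT lieX.
(* Coefficients of [e] may be compared because [e != 0]. *)
apply/matrixP => i j; apply/eqP; rewrite -subr_eq0.
by rewrite -[_ == _](orbF) -(negPf e0) -scaler_eq0 scalerBl -lieJX oJ lieX subrr.
Qed.

End LieBilinear.

(** The square of the form matrix is minus the identity. *)
Lemma symp_form_unit (F : fieldType) n : symp_form F n \in unitmx.
Proof.
have: symp_form F n *m - symp_form F n = 1%:M.
  rewrite mulmxN /symp_form mulmx_block !mulmx0 !mul0mx !mulmx1 !mul1mx.
  by rewrite !addr0 !add0r opp_block_mx opprK oppr0 -scalar_mx_block.
by case/mulmx1_unit.
Qed.

Lemma block_form_invariant (F : fieldType) m1 m2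
    (S : 'M[F]_m2) (A : 'M[F]_(m1 + m2)) :
    S \in unitmx ->
  A^T *m block_mx 0 0 0 S *m A = block_mx 0 0 0 S <->
  dlsubmx A = 0 /\ (drsubmx A)^T *m S *m drsubmx A = S.
Proof.
move=> uS; rewrite -{1 2}[A]submxK.
set c := dlsubmx A; set M := drsubmx A.
rewrite tr_block_mx !mulmx_block !(mulmx0, mul0mx, addr0, add0r).
(* The upper blocks of [A] have dropped out: they only meet the radical of the form. *)
split=> [/eq_block_mx[_ cM _ MM]|[-> ->]]; last by rewrite trmx0 !mul0mx mulmx0.
split=> //; have uM : M \in unitmx.
  move: (uS); rewrite -{1}MM -!mulmxA unitmx_mul => /andP[_].
  by rewrite unitmx_mul => /andP[].
apply: trmx_inj; rewrite trmx0.
(* Here [c^T] is written as [c^T S M M^-1 S^-1]. *)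
by rewrite -(mulmxK uS c^T) -(mulmxK uM (c^T *m S)) cM !mul0mx.
Qed.

(** The first row and column vanish because [e] is central. The minus sign appears because
    [symp_form] has [-1] in the block of the pairs [(p, q)], where the bracket gives [+e]. *)
Lemma heisenberg_lie_basis (F : fieldType) (n : nat) (L : lieAlgType F)
    (e : L) (p q : n.-tuple L) :
  heisenberg_basis e p q ->
  forall i j : 'I_(1 + (n + n)),
  lie (tnth [tuple of e :: p ++ q] i) (tnth [tuple of e :: p ++ q] j) =
  (block_mx 0 0 0 (- symp_form F n) : 'M_(1 + (n + n))) i j *: e.
Proof.
(* The length [(n + n).+1] is convertible to [1 + (n + n)], so [lshift] and [rshift] can separate
   [e] from [p] and [q]. *)
case=> _ e_p e_q p_p q_q p_q; set X : (1 + (n + n)).-tuple L := [tuple of e :: p ++ q].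
have Xe : tnth X (lshift (n + n) ord0) = e by [].
have Xr k : tnth X (rshift 1 k) = tnth [tuple of p ++ q] k.
  by rewrite !(tnth_nth e).
have Xp k : tnth X (rshift 1 (lshift n k)) = tnth p k by rewrite Xr tnth_lshift.
have Xq k : tnth X (rshift 1 (rshift n k)) = tnth q k by rewrite Xr tnth_rshift.
have eX k : lie e (tnth X (rshift 1 k)) = 0.
  by case: (split_ordP k) => k' ->; rewrite ?Xp ?Xq.
rewrite /symp_form opp_block_mx !oppr0 opprK.
move=> i j; case: (split_ordP i) => i' ->; case: (split_ordP j) => j' ->.
- by rewrite !ord1 block_mxEul mxE scale0r Xe lie_alt.
- by rewrite ord1 block_mxEur mxE scale0r Xe eX.
- by rewrite ord1 block_mxEdl mxE scale0r Xe lie_anti eX oppr0.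
rewrite block_mxEdr.
case: (split_ordP i') => k ->; case: (split_ordP j') => l ->; rewrite ?Xp ?Xq.
- by rewrite p_p block_mxEul mxE scale0r.
- by rewrite p_q block_mxEur mxE; case: eqP; rewrite ?scale1r ?scale0r.
- rewrite lie_anti p_q block_mxEdl !mxE eq_sym.
  by case: eqP; rewrite ?scaleN1r // !oppr0 scale0r.
- by rewrite q_q block_mxEdr mxE scale0r.
Qed.

Theorem theorem4 (F : fieldType) (charF0 : [pchar F] =i pred0)
    (n : nat) (n_gt0 : (0 < n)%N)
    (L : lieAlgType F) (e : L) (p q : n.-tuple L)
    (Hepq : heisenberg_basis e p q) (J : 'End(L)) :
  lie_orthogonal J <->
  exists (r : F) (R : 'M[F]_(1, n + n)) (Jhat : 'M[F]_(n + n)),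
    Jhat \in Sp F n /\
    op_mx [tuple of e :: p ++ q] J = block_mx r%:M R 0 Jhat.
Proof.
have bX := heis_basis Hepq.
have e0 : e != 0.
  by apply: contraTneq (basis_free bX) => ->; rewrite free_cons mem0v.
apply: iff_trans (lie_orthogonal_mx J bX e0 (heisenberg_lie_basis Hepq)) _.
have uS : - symp_form F n \in unitmx.
  by rewrite -scaleN1r unitmxZ ?symp_form_unit // unitrN unitr1.
set A : 'M_(1 + (n + n)) := op_mx _ _.
(* The sign of the form is pulled out, since [Sp] is stated for [symp_form] itself. *)
apply: iff_trans (block_form_invariant A uS) _; rewrite mulmxN mulNmx.
split=> [[c0 /oppr_inj MSp]|[r [R [M [/eqP MSp ->]]]]].
  exists (ulsubmx A 0 0), (ursubmx A), (drsubmx A); split; first exact/eqP.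
  by rewrite -mx11_scalar -c0 submxK.
by rewrite block_mxKdl block_mxKdr MSp.
Qed.
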